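(* Let $\mathcal{G}=(\mathcal{V},\mathcal{E})$ be a digraph on $n>1$ nodes, and fix activation probabilities $p_{ij}$ and updating weights $w_{ij}$ as in the context. Then $\mathcal{G}$ is strongly connected if and only if there exists $\bar\epsilon>0$ such that for every $\epsilon\in(0,\bar\epsilon)$ the gossip algorithm with parameter $\epsilon$ achieves mean-square average consensus.
   Context: Setting: $\mathcal{V}=\{1,\dots,n\}$, $n>1$, and $\mathcal{G}$ has no selfloops. An edge $(j,i)$ means that $j$ sends to $i$. To each edge $(j,i)\in\mathcal{E}$ are assigned a probability $p_{ij}\in(0,1)$, with $\sum_{(j,i)\in\mathcal{E}}p_{ij}=1$, and an updating weight $w_{ij}\in(0,1)$. Gossip algorithm with parameter $\epsilon>0$: at each time $k\in\mathbb{Z}_+$, exactly one edge is activated. The choice is independent of the past, and edge $(j,i)$ is activated with probability $p_{ij}$. If $(j,i)$ is activated, then $$x_i(k+1)=x_i(k)+w_{ij}(x_j(k)-x_i(k))+\epsilon w_{ij}s_i(k),\qquad s_i(k+1)=s_i(k)+s_j(k)-(x_i(k+1)-x_i(k)),$$ $$x_j(k+1)=x_j(k),\qquad s_j(k+1)=0,$$ and $x_l(k+1)=x_l(k)$, $s_l(k+1)=s_l(k)$ for every other node $l$. The initial condition is $s(0)=0$ with $x(0)\in\mathbb{R}^n$ arbitrary (deterministic). Mean-square average consensus: for every $x(0)$, $E[\|x(k)-x_a\mathbf{1}\|_2^2]\to0$ and $E[\|s(k)\|_2^2]\to0$ as $k\to\infty$, where $x_a=\mathbf{1}^Tx(0)/n$.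 *)

(* Defs.v *)
From HB Require Import structures.
From mathcomp Require Import all_boot all_order all_algebra.
From mathcomp Require Import all_classical all_reals topology normedtype sequences.
Set Implicit Arguments. Unset Strict Implicit. Unset Printing Implicit Defensive.
Import Order.TTheory GRing.Theory Num.Theory.
Import numFieldNormedType.Exports.
Local Open Scope classical_set_scope.
Local Open Scope ring_scope.

(* A digraph on nodes 'I_n is an edge relation E : rel 'I_n ;
   E j i  means the edge (j,i) is present: j sends to i.
   Parameters p i j = p_{ij}, w i j = w_{ij} for the edge (j,i).
   States are pairs (x, s) of functions 'I_n -> R.
   An edge is encoded as the pair (j, i). *)

Section Gossip.
Variables (R : realType) (n : nat).
Definition state := (('I_n -> R) * ('I_n -> R))%type.

Definition gossip_step (w : 'I_n -> 'I_n -> R) (eps : R)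
    (e : 'I_n * 'I_n) (st : state) : state :=
  let j := e.1 in let i := e.2 in
  let x := st.1 in let s := st.2 in
  let xi' := x i + w i j * (x j - x i) + eps * w i j * s i in
  ((fun l => if l == i then xi' else x l),
   (fun l => if l == i then s i + s j - (xi' - x i)
             else if l == j then 0 else s l)).

Definition gossip_run w eps (t : seq ('I_n * 'I_n)) (st : state) : state :=
  foldl (fun st e => gossip_step w eps e st) st t.

Definition edge_prob (E : rel 'I_n) (p : 'I_n -> 'I_n -> R) (e : 'I_n * 'I_n) : R :=
  if E e.1 e.2 then p e.2 e.1 else 0.

(* Expectation of f(state at time k), edges chosen i.i.d. with edge_prob,
   starting from x(0) = x0, s(0) = 0. *)
Definition gossip_expect E p w eps (x0 : 'I_n -> R) (k : nat) (f : state -> R) : R :=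
  \sum_(t : k.-tuple ('I_n * 'I_n))
     (\prod_(e <- t) edge_prob E p e) * f (gossip_run w eps t (x0, fun _ => 0)).

Definition sqnorm (v : 'I_n -> R) : R := \sum_(l < n) v l ^+ 2.

Definition xavg (x0 : 'I_n -> R) : R := (\sum_(l < n) x0 l) / n%:R.

Definition ms_average_consensus E p w eps : Prop :=
  forall x0 : 'I_n -> R,
    (fun k => gossip_expect E p w eps x0 k
                (fun st => sqnorm (fun l => st.1 l - xavg x0))) @ \oo --> (0 : R)
    /\
    (fun k => gossip_expect E p w eps x0 k (fun st => sqnorm st.2)) @ \oo --> (0 : R).

Definition strongly_connected (E : rel 'I_n) : Prop := forall u v, connect E u v.
End Gossip.

(* Main.v *)
Require Import Defs.
From HB Require Import structures.
From mathcomp Require Import all_boot all_order all_algebra.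
From mathcomp Require Import all_classical all_reals topology normedtype sequences.
From mathcomp Require Import ring lra.
Set Implicit Arguments. Unset Strict Implicit. Unset Printing Implicit Defensive.
Import Order.TTheory GRing.Theory Num.Theory.
Import numFieldNormedType.Exports.
Local Open Scope ring_scope.

(* Sufficiency.  Put z = x - x_a and S = \sum_l s l; the sum of all z and s
   entries stays 0.  At eps = 0 the form q = \sum_l v l * z l ^+ 2, with v the
   stationary weights of the averaging dynamics, loses a Dirichlet form D of z at
   each step, while s is transported by coalescing random walks.  For eps > 0 the
   mean of q also picks up, at order eps, the indefinite term
   - (2 eps / n) * S * (a . s) with a > 0.  Adding eps times a quadratic form in s
   repairs this: - (2 / n) * S * (h . s), where h solves the Poisson equation
   a = h - walk h + alpha (alpha > 0), turns that term into
   - (2 eps alpha / n) * S ^+ 2, and a multiple of the energy U of the coalescing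
   transport dissipates |s|^2 up to S ^+ 2.  All remaining errors are
   O(eps * sqrt D * |s| + eps^2 * |s|^2 + eps * D), hence absorbed for small eps,
   and the mean of |z|^2 + |s|^2 is summable in time.

   Necessity.  If v is not reachable from u, start from the indicator of the
   nodes reachable from u: the other nodes keep x = s = 0 forever. *)

(** Dimension count: linearity and extensionality make [Phi] an endomorphism of [{ffun T -> R^o}],
    where injectivity forces surjectivity. This solves the Poisson and meeting-time equations
    below. *)
Lemma surjective_of_trivial_kernel (R : realType) (T : finType)
    (Phi : (T -> R) -> T -> R) :
  (forall (c : R) f g x, Phi (fun y => c * f y + g y) x = c * Phi f x + Phi g x) ->
  (forall f g, f =1 g -> Phi f =1 Phi g) ->
  (forall f, (forall x, Phi f x = 0) -> forall x, f x = 0) ->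
  forall b, exists f, forall x, Phi f x = b x.
Proof.
move=> lin ext inj b.
pose F (f : {ffun T -> R^o}) : {ffun T -> R^o} := [ffun x => Phi f x].
have linF : linear F.
  move=> c f g; apply/ffunP => x; rewrite /F !ffunE.
  rewrite -[RHS]/(c * Phi f x + Phi g x) -lin.
  by apply: ext => y; rewrite !ffunE.
pose mF := GRing.isLinear.Build R _ _ _ F linF.
pose L : {linear _ -> _} := HB.pack F mF.
have kerL : lker (linfun L) == 0%VS.
  rewrite -subv0; apply/subvP => f; rewrite memv_ker lfunE /= memv0 => /eqP Lf.
  apply/eqP/ffunP => x; rewrite ffunE; apply: inj => y.
  by move/ffunP: Lf => /(_ y); rewrite !ffunE.
pose b' : {ffun T -> R^o} := [ffun x => b x].
have : b' \in limg (linfun L) by rewrite lker0_limgf// memvf.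
case/memv_imgP => f _ /ffunP bf; exists f => x.
by have := bf x; rewrite lfunE /= !ffunE.
Qed.

(** * Averages over a random index and Markov operators of random maps *)

Section RandomMaps.
Context {R : realType} {I : finType}.
Variable P : I -> R.
Hypothesis P_ge0 : forall e, 0 <= P e.
Hypothesis P_sum1 : \sum_e P e = 1.

Definition avg (f : I -> R) : R := \sum_e P e * f e.

Lemma eq_avg f g : f =1 g -> avg f = avg g.
Proof. by move=> fg; apply: eq_bigr => e _; rewrite fg. Qed.

Lemma avg_lin c f g : avg (fun e => c * f e + g e) = c * avg f + avg g.
Proof.
rewrite /avg mulr_sumr -big_split /=; apply: eq_bigr => e _; ring.
Qed.

Lemma avgD f g : avg (fun e => f e + g e) = avg f + avg g.
Proof. by rewrite /avg -big_split /=; apply: eq_bigr => e _; ring. Qed.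

Lemma avgZ c f : avg (fun e => c * f e) = c * avg f.
Proof. by rewrite /avg mulr_sumr; apply: eq_bigr => e _; ring. Qed.

Lemma avg_cst c : avg (fun=> c) = c.
Proof. by rewrite /avg -mulr_suml P_sum1 mul1r. Qed.

Lemma avg_sum (J : finType) (F : J -> I -> R) :
  avg (fun e => \sum_j F j e) = \sum_j avg (F j).
Proof.
by rewrite /avg exchange_big; apply: eq_bigr => e _; rewrite mulr_sumr.
Qed.

Lemma ler_avg f g : (forall e, 0 < P e -> f e <= g e) -> avg f <= avg g.
Proof.
move=> fg; apply: ler_sum => e _.
have := P_ge0 e; rewrite le_eqVlt => /predU1P[<-|Pe]; first by rewrite !mul0r.
by rewrite ler_pM2l// fg.
Qed.

Lemma avg_ge0 f : (forall e, 0 < P e -> 0 <= f e) -> 0 <= avg f.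
Proof. by move=> f0; rewrite -[0](avg_cst 0); exact: ler_avg. Qed.

Lemma avg_eq0 f e : (forall e, 0 < P e -> 0 <= f e) -> avg f = 0 -> 0 < P e ->
  f e = 0.
Proof.
move=> f0 /eqP; rewrite /avg psumr_eq0 => [|i _]; last first.
  have := P_ge0 i; rewrite le_eqVlt => /predU1P[<-|Pi]; first by rewrite mul0r.
  by rewrite mulr_ge0// f0.
move=> /allP/(_ e); rewrite mem_index_enum => /(_ isT) /= /eqP Pf Pe.
by move/eqP: Pf; rewrite mulf_eq0 (gt_eqF Pe) => /eqP.
Qed.

Section Transfer.
Context {T : finType}.
Variable mv : I -> T -> T.

Definition transfer (f : T -> R) (x : T) : R := avg (fun e => f (mv e x)).

Lemma ler_transfer f g : (forall x, f x <= g x) ->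
  forall x, transfer f x <= transfer g x.
Proof. by move=> fg x; exact: ler_avg. Qed.

(** Maximum principle: the differences [f x - f (mv e x)] are nonnegative with mean at most 0, so
    each one of positive probability vanishes. *)
Lemma transfer_max f x e : (forall y, f y <= f x) -> f x <= transfer f x ->
  0 < P e -> f (mv e x) = f x.
Proof.
move=> fx le_fx Pe; apply/eqP; rewrite eq_sym -subr_eq0; apply/eqP.
apply: (@avg_eq0 (fun e => f x - f (mv e x))) => // [i _|]; first by rewrite subr_ge0.
rewrite (eq_avg (g := fun e => (-1) * f (mv e x) + f x)); last by move=> i; ring.
apply/eqP; rewrite avg_lin avg_cst eq_le -/(transfer f x).
have : transfer f x <= f x by rewrite -[leRHS]avg_cst; exact: ler_avg.
lra.
Qed.

Lemma transfer_lin c f g x :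
  transfer (fun y => c * f y + g y) x = c * transfer f x + transfer g x.
Proof. exact: avg_lin. Qed.

Lemma eq_transfer f g : f =1 g -> transfer f =1 transfer g.
Proof. by move=> fg x; apply: eq_avg => e; rewrite fg. Qed.

End Transfer.
End RandomMaps.

Lemma fin_argmax (R : realType) (T : finType) (x0 : T) (f : T -> R) :
  exists x, forall y, f y <= f x.
Proof. by exists [arg max_(x > x0) f x]%O; case: arg_maxP => // x _ + y; apply. Qed.

Lemma fin_argmin (R : realType) (T : finType) (x0 : T) (f : T -> R) :
  exists x, forall y, f x <= f y.
Proof. by exists [arg min_(x < x0) f x]%O; case: arg_minP => // x _ + y; apply. Qed.

Lemma connect_closed (T : finType) (r : rel T) (Q : T -> Prop) x y :
  (forall u v, r u v -> Q u -> Q v) -> connect r x y -> Q x -> Q y.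
Proof.
move=> rQ /connectP[s + ->]; elim: s x => //= z s IHs x /andP[rxz sP] Qx.
by apply: IHs sP _; exact: rQ Qx.
Qed.

(** * Quadratic forms and the transport of [s] along an edge *)

Section QuadraticForms.
Context {R : realType} {n : nat}.
Implicit Types (K : 'I_n * 'I_n -> R) (s u : 'I_n -> R) (e : 'I_n * 'I_n).

Definition qform K s : R := \sum_k \sum_l K (k, l) * (s k * s l).

Lemma eq_qform K K' s : K =1 K' -> qform K s = qform K' s.
Proof.
by move=> KK'; apply: eq_bigr => k _; apply: eq_bigr => l _; rewrite KK'.
Qed.

Lemma qformD K K' s : qform (fun kl => K kl + K' kl) s = qform K s + qform K' s.
Proof.
rewrite /qform -big_split; apply: eq_bigr => k _ /=.
by rewrite -big_split; apply: eq_bigr => l _; rewrite mulrDl.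
Qed.

Lemma qformZ c K s : qform (fun kl => c * K kl) s = c * qform K s.
Proof.
rewrite /qform mulr_sumr; apply: eq_bigr => k _.
by rewrite mulr_sumr; apply: eq_bigr => l _; ring.
Qed.

Lemma qform_sum (J : finType) (K : J -> 'I_n * 'I_n -> R) s :
  qform (fun kl => \sum_j K j kl) s = \sum_j qform (K j) s.
Proof.
rewrite /qform [RHS]exchange_big; apply: eq_bigr => k _ /=.
by rewrite [RHS]exchange_big; apply: eq_bigr => l _; rewrite mulr_suml.
Qed.

Lemma qform_rank1 (g h : 'I_n -> R) s :
  qform (fun kl => g kl.1 * h kl.2) s = (\sum_k g k * s k) * (\sum_l h l * s l).
Proof.
rewrite mulr_suml; apply: eq_bigr => k _.
by rewrite mulr_sumr; apply: eq_bigr => l _ /=; ring.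
Qed.

Lemma qform_diag s : qform (fun kl => (kl.1 == kl.2)%:R) s = sqnorm s.
Proof.
apply: eq_bigr => k _; rewrite (bigD1 k)//= eqxx mul1r big1 ?addr0// => l.
by rewrite eq_sym => /negbTE ->; rewrite mul0r.
Qed.

Lemma qform_norm_le K s c r : (forall kl, `|K kl| <= c) -> (forall k, `|s k| <= r) ->
  `|qform K s| <= n%:R ^+ 2 * c * r ^+ 2.
Proof.
move=> Kc sr; apply: (le_trans (ler_norm_sum _ _ _)).
have -> : n%:R ^+ 2 * c * r ^+ 2 = \sum_(k < n) \sum_(l < n) c * (r * r).
  by rewrite !sumr_const !card_ord; ring.
apply: ler_sum => k _; apply: (le_trans (ler_norm_sum _ _ _)).
by apply: ler_sum => l _; rewrite !normrM !ler_pM// mulr_ge0.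
Qed.

Lemma ler_abs_sqnorm s k : `|s k| <= Num.sqrt (sqnorm s).
Proof.
rewrite -sqrtr_sqr ler_wsqrtr// /sqnorm (bigD1 k)//= lerDl.
by apply: sumr_ge0 => l _; exact: sqr_ge0.
Qed.

Lemma sqnorm_ge0 s : 0 <= sqnorm s.
Proof. by apply: sumr_ge0 => l _; exact: sqr_ge0. Qed.

(** Coalescing tokens: activating [e] sends a token at [e.1] to [e.2]. [push] is the dual action on
    masses, the update of [s] before the change of [x] is subtracted. *)
Definition move e k : 'I_n := if k == e.1 then e.2 else k.
Definition move2 e (kl : 'I_n * 'I_n) := (move e kl.1, move e kl.2).
Definition push e s l : R :=
  if l == e.2 then s e.2 + s e.1 else if l == e.1 then 0 else s l.

Lemma sum_push (h : 'I_n -> R) s e : e.1 != e.2 ->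
  \sum_l h l * push e s l = \sum_k h (move e k) * s k.
Proof.
move=> ne; rewrite (bigD1 e.2)//= (bigD1 e.1)//=.
rewrite [RHS](bigD1 e.2)//= [X in _ = _ + X](bigD1 e.1)//=.
rewrite /push /move !eqxx [e.2 == _]eq_sym (negbTE ne) mulr0 add0r mulrDr -addrA.
by congr (_ + (_ + _)); apply: eq_bigr => k /andP[/negbTE -> /negbTE ->].
Qed.

(** The duality [sum_push] is used once in each variable: transporting [s] amounts to moving two
    tokens under the kernel. *)
Lemma qform_push K s e : e.1 != e.2 ->
  qform K (push e s) = qform (fun kl => K (move2 e kl)) s.
Proof.
move=> ne; rewrite /qform.
have -> : \sum_k \sum_l K (k, l) * (push e s k * push e s l) =
    \sum_k (\sum_l K (k, move e l) * s l) * push e s k.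
  apply: eq_bigr => k _; rewrite -(sum_push (fun l => K (k, l)) s ne) mulr_suml.
  by apply: eq_bigr => l _; ring.
rewrite (sum_push (fun k => \sum_l K (k, move e l) * s l))//.
by apply: eq_bigr => k _; rewrite mulr_suml; apply: eq_bigr => l _ /=; ring.
Qed.

Lemma push_abs_le s e r : (forall k, `|s k| <= r) -> forall k, `|push e s k| <= 2 * r.
Proof.
move=> sr k; have r0 : 0 <= r by exact: le_trans (sr k).
rewrite /push; case: eqP => _.
  by rewrite (le_trans (ler_normD _ _))// mulrDl mul1r lerD.
case: eqP => _; first by rewrite normr0; lra.
by apply: (le_trans (sr k)); lra.
Qed.

(** Only one entry of [u] changes, so the difference has terms linear in [d] and one in [d ^+ 2].
    The constant, twice the total absolute value of [K], depends on [K] alone. *)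
Lemma qform_perturb K : exists2 c, 0 <= c & forall u i (d r : R),
  (forall k, `|u k| <= r) ->
  qform K (fun l => u l - d * (l == i)%:R) <= qform K u + c * (`|d| * r + d ^+ 2).
Proof.
pose c := \sum_k \sum_l `|K (k, l)|.
have c0 : 0 <= c by apply: sumr_ge0 => k _; apply: sumr_ge0.
exists (2 * c) => [|u i d r ur]; first by rewrite mulr_ge0.
have r0 : 0 <= r by exact: le_trans (ur i).
rewrite -lerBlDl /qform -sumrB.
have -> : 2 * c * (`|d| * r + d ^+ 2) =
    \sum_k \sum_l `|K (k, l)| * (2 * (`|d| * r + d ^+ 2)).
  rewrite [2 * c]mulrC -mulrA /c mulr_suml; apply: eq_bigr => k _.
  by rewrite mulr_suml.
apply: ler_sum => k _; rewrite -sumrB; apply: ler_sum => l _.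
rewrite -mulrBr; apply: (le_trans (ler_norm _)); rewrite normrM ler_wpM2l//.
have -> : (u k - d * (k == i)%:R) * (u l - d * (l == i)%:R) - u k * u l =
  - (d * u k) * (l == i)%:R - (d * u l) * (k == i)%:R
  + d ^+ 2 * (k == i)%:R * (l == i)%:R by ring.
have du x : `|d * u x| <= `|d| * r by rewrite normrM ler_wpM2l.
have d2 : `|d ^+ 2| = d ^+ 2 by rewrite ger0_norm// sqr_ge0.
have b x (b : bool) : `|x * b%:R : R| <= `|x|.
  by case: b; rewrite ?mulr1 ?mulr0 ?normr0.
apply: (le_trans (ler_normD _ _)); rewrite mulrDr lerD//; last first.
  apply: (le_trans (b _ _)); apply: (le_trans (b _ _)); rewrite d2.
  by have := sqr_ge0 d; lra.
apply: (le_trans (ler_normB _ _)); rewrite mulrDl mul1r lerD//;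
  by apply: (le_trans (b _ _)); rewrite ?normrN.
Qed.

End QuadraticForms.

(** * Random walks of one token and of two coalescing tokens *)

Section TokenWalk.
Context {R : realType} {n : nat}.
Variable P : 'I_n * 'I_n -> R.
Hypothesis P_ge0 : forall e, 0 <= P e.
Hypothesis P_sum1 : \sum_e P e = 1.
Hypothesis P_loopless : forall e, 0 < P e -> e.1 != e.2.
Hypothesis P_connected : forall u v, connect (fun j i => 0 < P (j, i)) u v.
Variable o : 'I_n.

Local Notation walk := (transfer P move).
Local Notation walk2 := (transfer P move2).

Lemma avg_qform_push K (s : 'I_n -> R) :
  avg P (fun e => qform K (push e s)) = qform (walk2 K) s.
Proof.
have -> : avg P (fun e => qform K (push e s)) =
          avg P (fun e => qform (fun kl => K (move2 e kl)) s).
  apply: eq_bigr => e _; have := P_ge0 e; rewrite le_eqVlt => /predU1P[<-|Pe].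
    by rewrite !mul0r.
  by rewrite qform_push// P_loopless.
rewrite /qform avg_sum; apply: eq_bigr => k _; rewrite avg_sum.
apply: eq_bigr => l _; rewrite /transfer [RHS]mulrC -avgZ.
by apply: eq_avg => e; rewrite mulrC.
Qed.

(** By [transfer_max] the maximisers of [h] are closed along active edges, hence exhaust all
    nodes. *)
Lemma harmonic_cst h : (forall y, walk h y = h y) -> forall x y, h x = h y.
Proof.
move=> harm; have [x hx] := fin_argmax o h.
suff hE y : h y = h x by move=> y z; rewrite !hE.
apply: (connect_closed (Q := fun y => h y = h x)) (P_connected x y) _ => //.
move=> u v Puv hu.
have := @transfer_max _ _ _ P_ge0 P_sum1 _ move h u (u, v) _ _ Puv.
rewrite /move /= eqxx => ->//; first by move=> z; rewrite hu.
by rewrite harm.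
Qed.

Lemma poisson_solution (a : 'I_n -> R) : (forall k, 0 < a k) ->
  exists h, exists2 alpha, 0 < alpha & forall k, a k = h k - walk h k + alpha.
Proof.
move=> a_gt0.
(* One unknown per node: the solution is normalised by [h o = 0], and the
   freed coordinate [g o] carries [alpha]. *)
pose pin (g : 'I_n -> R) k := if k == o then 0 else g k.
pose Phi (g : 'I_n -> R) k := pin g k - walk (pin g) k + g o.
have [] := @surjective_of_trivial_kernel R _ Phi _ _ _ a.
- move=> c f g x; rewrite /Phi.
  rewrite (@eq_transfer _ _ _ _ _ (pin (fun y => c * f y + g y))
    (fun y => c * pin f y + pin g y)); last first.
    by move=> y; rewrite /pin; case: ifP => _ //; ring.
  by rewrite transfer_lin /pin; case: ifP => _; ring.
- move=> f g fg x; rewrite /Phi fg /pin.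
  rewrite (@eq_transfer _ _ _ _ _ (fun k => if k == o then 0 else f k)
    (fun k => if k == o then 0 else g k)) ?fg// => y.
  by rewrite fg.
(* Trivial kernel: a maximiser of [pin g] gives [g o <= 0] and a minimiser [0 <= g o]; then [pin g]
   is harmonic and vanishes at [o]. *)
- move=> g Phig.
  have [x hx] := fin_argmax o (pin g).
  have [y hy] := fin_argmin o (pin g).
  have wx : walk (pin g) x <= pin g x.
    by rewrite -[leRHS](avg_cst P_sum1); exact: ler_avg.
  have wy : pin g y <= walk (pin g) y.
    by rewrite -[leLHS](avg_cst P_sum1); exact: ler_avg.
  have g0 : g o = 0.
    apply/eqP; rewrite eq_le; have := Phig x; have := Phig y; rewrite /Phi.
    by move=> H1 H2; apply/andP; split; lra.
  have harm k : walk (pin g) k = pin g k by have := Phig k; rewrite /Phi g0; lra.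
  move=> k; have := harmonic_cst harm o k; rewrite /pin eqxx.
  by case: eqP => [->|].
move=> g ag; exists (pin g), (g o) => [|k]; last by rewrite -ag.
(* At a minimiser [y] averaging cannot lower [pin g], so [g o >= a y > 0]. *)
have [y hy] := fin_argmin o (pin g).
have wy : pin g y <= walk (pin g) y.
  by rewrite -[leLHS](avg_cst P_sum1); exact: ler_avg.
by have := ag y; have := a_gt0 y; rewrite /Phi; lra.
Qed.

(** From a positive maximum at [(x, l)], lead the first token along a path to [l] while the second
    rests. Each move keeps the value, contradicting [g (l, l) = 0]. *)
Lemma absorbed_le0 (g : 'I_n * 'I_n -> R) : (forall k, g (k, k) = 0) ->
  (forall k l, k != l -> g (k, l) = walk2 g (k, l)) -> forall kl, g kl <= 0.
Proof.
move=> g0 harm kl; have [[x l] gx] := fin_argmax (o, o) g.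
apply: (le_trans (gx kl)); rewrite leNgt; apply/negP => gx0.
suff : g (l, l) = g (x, l) by rewrite g0 => gE; rewrite -gE ltxx in gx0.
apply: (connect_closed (Q := fun y => g (y, l) = g (x, l))) (P_connected x l) _ => //.
move=> u v Puv gu; have ul : u != l.
  by apply/eqP => ul; rewrite -gu ul g0 ltxx in gx0.
have := @transfer_max _ _ _ P_ge0 P_sum1 _ move2 g (u, l) (u, v) _ _ Puv.
rewrite /move2 /move /= eqxx eq_sym (negbTE ul) gu => ->//.
by rewrite -gu harm.
Qed.

(** [tau] is the mean time until two tokens coalesce, found from the Dirichlet problem with value 0
    on the diagonal. Applying [absorbed_le0] to a kernel element and to its negative gives
    injectivity. *)
Lemma meeting_time : exists tau : 'I_n * 'I_n -> R,
  (forall kl, 0 <= tau kl) /\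
  forall kl, tau kl = walk2 tau kl + (kl.1 != kl.2)%:R.
Proof.
pose Phi (g : 'I_n * 'I_n -> R) kl :=
  if kl.1 == kl.2 then g kl else g kl - walk2 g kl.
have [] := @surjective_of_trivial_kernel R _ Phi _ _ _
  (fun kl => (kl.1 != kl.2)%:R).
- move=> c f g x; rewrite /Phi; case: ifP => _ //.
  by rewrite transfer_lin; ring.
- by move=> f g fg x; rewrite /Phi fg (eq_transfer P move2 fg).
- move=> g Phig.
  have g0 k : g (k, k) = 0 by have := Phig (k, k); rewrite /Phi eqxx.
  have harm k l : k != l -> g (k, l) = walk2 g (k, l).
    by move=> kl; have := Phig (k, l); rewrite /Phi (negbTE kl)/=; lra.
  move=> kl; apply/eqP; rewrite eq_le absorbed_le0//= -oppr_le0.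
  apply: (@absorbed_le0 (fun kl => - g kl)) => [k|k l ne]; first by rewrite g0 oppr0.
  rewrite (@eq_transfer _ _ P _ move2 _ (fun y => (-1) * g y + 0)); last by move=> y; ring.
  by rewrite transfer_lin {2}/transfer (avg_cst P_sum1) -harm//; ring.
move=> tau tauE.
have tau0 k : tau (k, k) = 0 by have := tauE (k, k); rewrite /Phi eqxx.
(* Coalesced tokens stay together, so the equation also holds on the diagonal. *)
have diag k : walk2 tau (k, k) = 0.
  by rewrite /transfer /move2 /= (@eq_avg _ _ P _ (fun=> 0)) ?(avg_cst P_sum1).
have tauE' kl : tau kl = walk2 tau kl + (kl.1 != kl.2)%:R.
  have := tauE kl; rewrite /Phi; case: eqP; case: kl => k l /=; last by lra.
  by move=> ->; rewrite diag tau0 addr0.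
(* Off the diagonal a minimiser would satisfy both [tau = walk2 tau + 1] and [tau <= walk2 tau]; so
   the minimum is on the diagonal, where [tau] is 0. *)
exists tau; split=> // kl; have [[x l] taux] := fin_argmin (o, o) tau.
apply: (le_trans _ (taux kl)).
have : tau (x, l) <= walk2 tau (x, l).
  by rewrite -[leLHS](avg_cst P_sum1); exact: ler_avg.
have := tauE' (x, l) => /=; case: eqP => [->|_]; last by move=> /=; lra.
by rewrite tau0.
Qed.

(** The probability that tokens started at the two nodes of a pair have not met after [t] steps. *)
Definition apart t := iter t walk2 (fun kl => (kl.1 != kl.2)%:R : R).

Lemma apart_diag t k : apart t (k, k) = 0.
Proof.
elim: t k => [|t IHt] k; first by rewrite /apart /= eqxx.
rewrite /apart iterS -/(apart t) /transfer (@eq_avg _ _ P _ (fun=> 0)) => [|e].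
  exact: avg_cst.
exact: IHt.
Qed.

Lemma apart_ge0 t kl : 0 <= apart t kl.
Proof.
elim: t kl => [|t IHt] kl; first exact: ler0n.
by rewrite /apart iterS -/(apart t); apply: avg_ge0.
Qed.

Lemma apart_nincr t kl : apart t.+1 kl <= apart t kl.
Proof.
elim: t kl => [|t IHt] kl; last first.
  by rewrite {1}/apart iterS -/(apart _); exact: ler_transfer.
case: kl => k l; case: (eqVneq k l) => [->|kl]; first by rewrite !apart_diag.
rewrite {2}/apart /= kl -[leRHS](avg_cst P_sum1).
by apply: ler_avg => // e _; rewrite lern1 leq_b1.
Qed.

(** Sums of survival probabilities are at most [tau] and the terms do not increase in time, so
    [t * apart t <= tau]; take [t] beyond the maximum of [tau] divided by [c]. *)
Lemma apart_small (c : R) : 0 < c -> exists t, forall kl, apart t.+1 kl <= c.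
Proof.
move=> c0; have [tau [tau_ge0 tauE]] := meeting_time.
have sumE t kl : \sum_(i < t) apart i kl <= tau kl.
  (* Unfolding the equation of [tau] for [t] steps leaves a nonnegative remainder. *)
  suff -> : tau kl = \sum_(i < t) apart i kl + iter t walk2 tau kl.
    rewrite lerDl; elim: t kl => [|t IHt] kl; first exact: tau_ge0.
    by rewrite iterS; apply: avg_ge0.
  elim: t kl => [|t IHt] kl; first by rewrite big_ord0 add0r.
  rewrite IHt big_ord_recr /= -addrA; congr (_ + _); move: kl {IHt}.
  elim: t => [|t IHt] kl /=; first by rewrite {1}tauE addrC.
  rewrite [in LHS](@eq_transfer _ _ P _ move2 _ (fun y => 1 * apart t y + walk2 (iter t walk2 tau) y)).
    by rewrite transfer_lin mul1r.
  by move=> y; rewrite IHt mul1r.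
have apartS t i kl : apart (i + t) kl <= apart t kl.
  by elim: i => [|i IHi]; rewrite // addSn (le_trans (apart_nincr _ _)).
have avgE t kl : t%:R * apart t kl <= tau kl.
  apply: le_trans (sumE t kl); rewrite -[t in t%:R]card_ord mulr_natl -sumr_const.
  apply: ler_sum => i _; have := apartS i (t - i)%N kl.
  by rewrite subnK// ltnW.
have [x taux] := fin_argmax (o, o) tau.
exists (Num.trunc (tau x / c)) => kl; set t := (_.+1).
have t0 : 0 < t%:R :> R by rewrite ltr0n.
rewrite -(ler_pM2l t0); apply: (le_trans (avgE t kl)); apply: (le_trans (taux kl)).
by rewrite -ler_pdivrMr// ltW// truncnS_gt.
Qed.

(* [qform (fun kl => 1 - apart t kl) s] is the mean squared norm of [s] after
   [t] steps of coalescing transport, whence nonnegativity; once [apart t] is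
   small it is close to [(\sum_k s k) ^+ 2]. *)
Lemma coalescing_form : exists U : 'I_n * 'I_n -> R,
  (forall s, sqnorm s <= qform U s) /\
  (forall s, qform (walk2 U) s <= qform U s - sqnorm s / 2 + (\sum_k s k) ^+ 2).
Proof.
pose K t kl : R := 1 - apart t kl.
have walkK t kl : walk2 (K t) kl = K t.+1 kl.
  rewrite (@eq_transfer _ _ P _ move2 _ (fun y => (-1) * apart t y + 1)); last first.
    by move=> y; rewrite /K; ring.
  by rewrite transfer_lin {2}/transfer (avg_cst P_sum1) /K /apart iterS; ring.
have K0 s : qform (K 0%N) s = sqnorm s.
  rewrite -qform_diag; apply: eq_qform => -[k l]; rewrite /K /apart /=.
  by case: eqP => _; rewrite ?subr0 ?subrr.
have Kge0 t s : 0 <= qform (K t) s.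
  elim: t s => [|t IHt] s; first by rewrite K0 sqnorm_ge0.
  by rewrite -(eq_qform _ (walkK t)) -avg_qform_push avg_ge0.
have n0 : 0 < n%:R :> R by rewrite ltr0n (leq_ltn_trans _ (ltn_ord o)).
(* Chosen so that [n%:R ^+ 2 * c] is one half: the [apart] part of [K t.+1] then costs at most
   [sqnorm s / 2]. *)
pose c : R := (2 * n%:R ^+ 2)^-1.
have c0 : 0 < c by rewrite invr_gt0 mulr_gt0// exprn_gt0.
have [t tc] := apart_small c0.
have Kt s : qform (K t.+1) s <= sqnorm s / 2 + (\sum_k s k) ^+ 2.
  rewrite (eq_qform (K' := fun kl => -1 * apart t.+1 kl + 1 * 1)); last first.
    by move=> kl; rewrite /K; ring.
  rewrite qformD (qform_rank1 (fun=> 1) (fun=> 1)) qformZ mulN1r.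
  have -> : \sum_k 1 * s k = \sum_k s k by apply: eq_bigr => k _; rewrite mul1r.
  rewrite expr2 lerD2r; apply: (le_trans (ler_norm _)); rewrite normrN.
  apply: le_trans (qform_norm_le (c := c) _ (ler_abs_sqnorm s)) _.
    by move=> kl; rewrite ger0_norm// apart_ge0.
  rewrite sqr_sqrtr ?sqnorm_ge0// mulrC ler_wpM2l ?sqnorm_ge0//.
  by rewrite le_eqVlt; apply/orP; left; apply/eqP; rewrite /c; field; rewrite gt_eqF.
(* [walk2] sends [K i] to [K i.+1], so on this sum it only trades [K 0], the squared norm, for
   [K t.+1]. *)
exists (fun kl => \sum_(i < t.+1) K i kl); split=> s.
  rewrite qform_sum big_ord_recl K0 lerDl.
  by apply: sumr_ge0.
rewrite (eq_qform (K' := fun kl => \sum_(i < t.+1) K i.+1 kl)); last first.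
  move=> kl; rewrite {1}/transfer avg_sum.
  by apply: eq_bigr => i _; rewrite -walkK.
rewrite !qform_sum [X in X <= _]big_ord_recr [X in _ <= X - _ + _]big_ord_recl /= K0.
have := Kt s; lra.
Qed.

End TokenWalk.

Lemma sum_pair (R : realType) (n : nat) (F : 'I_n * 'I_n -> R) :
  \sum_e F e = \sum_j \sum_i F (j, i).
Proof. by rewrite pair_bigA; apply: eq_bigr => -[]. Qed.

(** * Stationary weights and a Poincare inequality *)

Section Consensus.
Context {R : realType} {n : nat}.
Variable P : 'I_n * 'I_n -> R.
Hypothesis P_ge0 : forall e, 0 <= P e.
Hypothesis P_connected : forall u v, connect (fun j i => 0 < P (j, i)) u v.

(** Perron-Frobenius argument for the generator [A] of the averaging dynamics: its rows sum to 0, so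
    it has a nonzero left null vector; the absolute values of its entries are again stationary, and
    connectivity makes them positive. *)
Lemma invariant_weights (w : 'I_n -> 'I_n -> R) (o : 'I_n) :
  (forall e, 0 < P e -> 0 < w e.2 e.1) ->
  exists2 v : 'I_n -> R, forall i, 0 < v i &
  forall f : 'I_n -> R, avg P (fun e => v e.2 * w e.2 e.1 * (f e.1 - f e.2)) = 0.
Proof.
move=> w_gt0; pose C i j := P (j, i) * w i j.
have C_gt0 i j : 0 < P (j, i) -> 0 < C i j.
  by move=> Pji; rewrite mulr_gt0// (w_gt0 (j, i)).
have C_ge0 i j : 0 <= C i j.
  have := P_ge0 (j, i); rewrite le_eqVlt => /predU1P[P0|/C_gt0/ltW//].
  by rewrite /C -P0 mul0r.
pose A := \matrix_(i, j) (C i j - (i == j)%:R * \sum_k C i k).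
have detA : \det A^T == 0.
  apply/det0P; exists (const_mx 1).
    by apply/eqP => /matrixP/(_ ord0 o); rewrite !mxE => /eqP; rewrite oner_eq0.
  apply/rowP => i; rewrite !mxE.
  under eq_bigr do rewrite !mxE mul1r.
  rewrite sumrB (bigD1 i)//= [X in _ - X](bigD1 i)//= eqxx mul1r.
  rewrite [X in _ - (_ + X)]big1 ?addr0; last first.
    by move=> k; rewrite eq_sym => /negbTE->; rewrite mul0r.
  by rewrite subrr.
rewrite det_tr in detA; have /det0P[v v_neq0 vA] := detA.
have vE j : \sum_i v ord0 i * C i j = v ord0 j * \sum_k C j k.
  have /rowP/(_ j) := vA; rewrite !mxE.
  under eq_bigr do rewrite !mxE mulrBr.
  rewrite sumrB => /eqP; rewrite subr_eq0 => /eqP ->.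
  rewrite (bigD1 j)//= eqxx mul1r [X in _ + X]big1 ?addr0// => i /negbTE->.
  by rewrite mul0r mulr0.
pose u i := `|v ord0 i|.
have u_ge0 i : 0 <= u i by exact: normr_ge0.
have u_le j : u j * \sum_k C j k <= \sum_i u i * C i j.
  have sC : 0 <= \sum_k C j k by apply: sumr_ge0.
  rewrite /u -{1}(ger0_norm sC) -normrM -vE.
  apply: (le_trans (ler_norm_sum _ _ _)); apply: ler_sum => i _.
  by rewrite normrM (ger0_norm (C_ge0 _ _)).
(* Both sides of [u_le] have the same sum over [j]. *)
have uE j : \sum_i u i * C i j = u j * \sum_k C j k.
  apply/eqP; rewrite -subr_eq0.
  have : \sum_j (\sum_i u i * C i j - u j * \sum_k C j k) == 0.
    rewrite sumrB exchange_big /= subr_eq0; apply/eqP.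
    by apply: eq_bigr => i _; rewrite mulr_sumr.
  rewrite psumr_eq0 => [/allP/(_ j)|i _]; last by rewrite subr_ge0.
  by rewrite mem_index_enum => /(_ isT).
exists u => [i|f].
  (* A zero of [u] at [a] spreads along every edge leaving [a], hence to all nodes, which would make
     [v] zero. *)
  rewrite lt_neqAle u_ge0 andbT eq_sym; apply: contraNneq v_neq0 => ui0.
  apply/eqP/rowP => k; rewrite mxE; apply/eqP; rewrite -normr_eq0 -/(u k); apply/eqP.
  apply: (connect_closed (Q := fun k => u k = 0)) (P_connected i k) ui0.
  move=> a b Pab ua0; have /eqP := uE a; rewrite ua0 mul0r psumr_eq0 => [|l _].
    move=> /allP/(_ b); rewrite mem_index_enum => /(_ isT) /=.
    by rewrite mulf_eq0 [C b a == 0]gt_eqF ?orbF ?C_gt0// => /eqP.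
  exact: mulr_ge0.
rewrite /avg sum_pair /=.
rewrite (eq_bigr (fun j => \sum_i (f j * (u i * C i j) - f i * (u i * C i j)))); last first.
  by move=> j _; apply: eq_bigr => i _; rewrite /C; ring.
under eq_bigr => j _ do rewrite sumrB -mulr_sumr uE.
rewrite sumrB [X in _ - X]exchange_big /=; apply/eqP; rewrite subr_eq0; apply/eqP.
by apply: eq_bigr => i _; rewrite -!mulr_sumr.
Qed.

(** Each edge difference is controlled by the Dirichlet form, and [(a + b)^2 <= 2 a^2 + 2 b^2]
    chains the bounds along paths. Summing the constants over all pairs makes them uniform; the
    added 1 keeps the inverse positive. *)
Lemma poincare (d : 'I_n * 'I_n -> R) : (forall e, 0 < P e -> 0 < d e) ->
  exists2 c, 0 < c & forall (z : 'I_n -> R) k l,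
    c * (z k - z l) ^+ 2 <= avg P (fun e => d e * (z e.1 - z e.2) ^+ 2).
Proof.
move=> d_gt0; pose D (z : 'I_n -> R) := avg P (fun e => d e * (z e.1 - z e.2) ^+ 2).
have term_ge0 z e : 0 <= P e * (d e * (z e.1 - z e.2 : R) ^+ 2).
  have := P_ge0 e; rewrite le_eqVlt => /predU1P[<-|Pe]; first by rewrite mul0r.
  by apply: mulr_ge0 (ltW Pe) (mulr_ge0 (ltW (d_gt0 _ Pe)) (sqr_ge0 _)).
have D_ge0 z : 0 <= D z by apply: sumr_ge0 => e _.
have pair kl : exists2 C, 0 <= C & forall z, (z kl.1 - z kl.2) ^+ 2 <= C * D z.
  case: kl => k l /=.
  apply: (connect_closed (Q := fun l => exists2 C, 0 <= C &
    forall z, (z k - z l) ^+ 2 <= C * D z)) (P_connected k l) _ => [a b Pab [C C0 CD]|].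
    have Pd : 0 < P (a, b) * d (a, b) by rewrite mulr_gt0// d_gt0.
    exists (2 * C + 2 * (P (a, b) * d (a, b))^-1) => [|z].
      by rewrite addr_ge0// mulr_ge0// invr_ge0 ltW.
    have : (z a - z b) ^+ 2 <= (P (a, b) * d (a, b))^-1 * D z.
      rewrite ler_pdivlMl// /D /avg (bigD1 (a, b))//= mulrA lerDl.
      by apply: sumr_ge0 => e _.
    have := CD z; have := sqr_ge0 ((z k - z a) - (z a - z b)).
    rewrite mulrDl -!mulrA !expr2; nra.
  by exists 0 => // z; rewrite subrr expr0n mul0r.
have [C C0 CD] := fin_all_exists2 pair.
have sC : 0 <= \sum_kl C kl by apply: sumr_ge0.
have sC1 : 0 < 1 + \sum_kl C kl by lra.
exists (1 + \sum_kl C kl)^-1 => [|z k l]; first by rewrite invr_gt0.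
rewrite ler_pdivrMl//; apply: (le_trans (CD (k, l) z)); rewrite ler_wpM2r//.
rewrite (bigD1 (k, l))//= addrCA lerDl addr_ge0//.
by apply: sumr_ge0.
Qed.

End Consensus.

(** * Elementary estimates *)

Lemma ler_prod_abs (R : realType) (x y a b : R) : `|x| <= a -> `|y| <= b -> x * y <= a * b.
Proof. by move=> xa yb; apply: (le_trans (ler_norm _)); rewrite normrM ler_pM. Qed.

Lemma centered_abs_le (R : realType) (n : nat) (z : 'I_n -> R) (r : R) :
  (forall k l, `|z k - z l| <= r) -> forall k, `|z k - (\sum_l z l) / n%:R| <= r.
Proof.
move=> zr k; have n0 : 0 < n%:R :> R by rewrite ltr0n (leq_ltn_trans _ (ltn_ord k)).
have -> : z k - (\sum_l z l) / n%:R = (\sum_l (z k - z l)) / n%:R.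
  by rewrite sumrB sumr_const card_ord -[_ *+ n]mulr_natr; field; rewrite gt_eqF.
rewrite normrM normfV (ger0_norm (ltW n0)) ler_pdivrMr//.
apply: (le_trans (ler_norm_sum _ _ _)); have -> : r * n%:R = \sum_(l < n) r by rewrite sumr_const card_ord mulr_natr.
exact: ler_sum.
Qed.

Lemma sqr_sum_le (R : realType) (n : nat) (z : 'I_n -> R) :
  (\sum_l z l) ^+ 2 <= n%:R ^+ 2 * sqnorm z.
Proof.
have : `|\sum_l z l| <= n%:R * Num.sqrt (sqnorm z).
  apply: (le_trans (ler_norm_sum _ _ _)).
  have -> : n%:R * Num.sqrt (sqnorm z) = \sum_(l < n) Num.sqrt (sqnorm z).
    by rewrite sumr_const card_ord mulr_natl.
  by apply: ler_sum => l _; exact: ler_abs_sqnorm.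
move=> le; rewrite -real_normK ?num_real// -[X in _ * X]sqr_sqrtr ?sqnorm_ge0//.
by rewrite -exprMn lerXn2r// ?nnegrE ?mulr_ge0 ?sqrtr_ge0.
Qed.

(** Here [c * r ^+ 2] will be the dissipation of [z] and [t] the norm of [s]. The errors use up half
    of [c * r ^+ 2] and half of the available [eps * (kap / 2) * t ^+ 2]. *)
Lemma error_absorbed (R : realType) (c kap vb C eps r t : R) :
  let K := 4 * vb + 4 * C in
  0 < c -> 0 <= vb -> 0 <= C -> 0 < eps <= 1 -> 0 <= r -> 0 <= t ->
  K * eps <= c / 4 -> (K ^+ 2 / c + K) * eps <= kap / 4 ->
  vb * (4 * eps * r * t + eps ^+ 2 * t ^+ 2) +
  eps * (C * ((r + eps * t) * (2 * t) + (r + eps * t) ^+ 2)) <=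
  c / 2 * r ^+ 2 + eps * (kap / 4) * t ^+ 2.
Proof.
move=> K c0 vb0 C0 /andP[eps0 eps1] r0 t0 K1 K2.
have e0 := ltW eps0.
have rt0 : 0 <= r * t by exact: mulr_ge0.
have K0 : 0 <= K by rewrite /K; lra.
(* Since [eps <= 1], higher powers of [eps] are lowered until three monomials dominate
   everything. *)
apply: (@le_trans _ _ (K * eps * (r * t) + K * (eps ^+ 2 * t ^+ 2) + K * eps * r ^+ 2)).
  have eps10 : 0 <= 1 - eps by rewrite subr_ge0.
  have H1 : 0 <= eps * (1 - eps) * (C * (r * t)) by rewrite !mulr_ge0.
  have H2 : 0 <= eps ^+ 2 * (1 - eps) * (C * t ^+ 2) by rewrite !mulr_ge0// sqr_ge0.
  have H3 : 0 <= eps ^+ 2 * (C * t ^+ 2) by rewrite !mulr_ge0// sqr_ge0.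
  have H4 : 0 <= eps ^+ 2 * (vb * t ^+ 2) by rewrite !mulr_ge0// sqr_ge0.
  have H5 : 0 <= eps * (C * r ^+ 2) by rewrite !mulr_ge0// sqr_ge0.
  have H6 : 0 <= eps * (vb * r ^+ 2) by rewrite !mulr_ge0// sqr_ge0.
  rewrite /K; lra.
have A1 : K * eps * r ^+ 2 <= c / 4 * r ^+ 2 by rewrite ler_wpM2r// sqr_ge0.
have A2 : eps * t ^+ 2 * ((K ^+ 2 / c + K) * eps) <= eps * t ^+ 2 * (kap / 4).
  by rewrite ler_wpM2l// mulr_ge0// sqr_ge0.
(* AM-GM: [K eps r t <= c r^2 / 4 + K^2 eps^2 t^2 / c] *)
have A3 : 0 <= c * (r / 2 - K * eps * t / c) ^+ 2 by rewrite mulr_ge0 ?sqr_ge0// ltW.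
have A4 : c * (r / 2 - K * eps * t / c) ^+ 2 =
  c / 4 * r ^+ 2 - K * eps * (r * t) + K ^+ 2 / c * eps ^+ 2 * t ^+ 2.
  by field; rewrite gt_eqF.
rewrite A4 in A3; lra.
Qed.

(** * A Lyapunov function for the gossip dynamics *)

Section Lyapunov.
Context {R : realType} {n : nat}.
Variable P : 'I_n * 'I_n -> R.
Variable w : 'I_n -> 'I_n -> R.
Hypothesis P_ge0 : forall e, 0 <= P e.
Hypothesis P_sum1 : \sum_e P e = 1.
Hypothesis P_loopless : forall e, 0 < P e -> e.1 != e.2.
Hypothesis P_connected : forall u v, connect (fun j i => 0 < P (j, i)) u v.
Hypothesis w_bounds : forall e, 0 < P e -> 0 < w e.2 e.1 < 1.
Variables o o' : 'I_n.
Hypothesis oo' : o != o'.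

Implicit Types (z s : 'I_n -> R) (e : 'I_n * 'I_n) (eps : R).

Definition incr eps e z s : R :=
  w e.2 e.1 * (z e.1 - z e.2) + eps * w e.2 e.1 * s e.2.
Definition next_z eps e z s l : R := z l + incr eps e z s * (l == e.2)%:R.
Definition next_s eps e z s l : R := push e s l - incr eps e z s * (l == e.2)%:R.

(** The vector [a] of the overview: its pairing with [s] is the mean of
    [v e.2 * w e.2 e.1 * s e.2]. *)
Definition rate (v : 'I_n -> R) k : R := v k * \sum_j P (j, k) * w k j.

(** At [eps = 0] the receiver's square changes by [w * (zj ^+ 2 - zi ^+ 2) - w * (1 - w) * (zj - zi)
    ^+ 2]. Weighted by [v], the first part has mean 0 by stationarity; this is the coefficient of
    the second. *)
Definition dissip (v : 'I_n -> R) e : R := v e.2 * (w e.2 e.1 * (1 - w e.2 e.1)).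

Lemma sum_next_z v eps e z s : \sum_l v l * next_z eps e z s l ^+ 2 =
  \sum_l v l * z l ^+ 2
  + v e.2 * (2 * z e.2 * incr eps e z s + incr eps e z s ^+ 2).
Proof.
rewrite (bigD1 e.2)//= [in RHS](bigD1 e.2)//= /next_z eqxx mulr1.
under eq_bigr => l /negbTE -> do rewrite mulr0 addr0.
by ring.
Qed.

Lemma avg_sum_next_z v vb eps z s r t :
  (forall i, 0 < v i <= vb) ->
  (forall f : 'I_n -> R, avg P (fun e => v e.2 * w e.2 e.1 * (f e.1 - f e.2)) = 0) ->
  0 < eps -> \sum_l z l = - \sum_l s l ->
  (forall k l, `|z k - z l| <= r) -> (forall k, `|s k| <= t) ->
  avg P (fun e => \sum_l v l * next_z eps e z s l ^+ 2) <=
  \sum_l v l * z l ^+ 2 - avg P (fun e => dissip v e * (z e.1 - z e.2) ^+ 2)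
  - 2 * eps / n%:R * (\sum_l s l) * (\sum_k rate v k * s k)
  + vb * (4 * eps * r * t + eps ^+ 2 * t ^+ 2).
Proof.
move=> vP vinv eps0 zs zr st; set S := \sum_l s l.
have rateE : \sum_k rate v k * s k = avg P (fun e => v e.2 * w e.2 e.1 * s e.2).
  rewrite /avg sum_pair exchange_big /=; apply: eq_bigr => k _.
  by rewrite /rate mulr_sumr mulr_suml; apply: eq_bigr => j _; ring.
have r0 : 0 <= r by exact: le_trans (zr o o).
have t0 : 0 <= t by exact: le_trans (st o).
set q := \sum_l v l * z l ^+ 2.
set err := vb * _.
(* Pointwise majorant: the dissipation, the cross term with [z e.2] replaced by the mean
   [- S / n%:R] of [z], a part of mean 0 by stationarity, and constants. *)
pose g e := (-1) * (dissip v e * (z e.1 - z e.2) ^+ 2) +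
  ((- (2 * eps / n%:R * S)) * (v e.2 * w e.2 e.1 * s e.2) +
  (v e.2 * w e.2 e.1 * (z e.1 ^+ 2 - z e.2 ^+ 2) + (q + err))).
apply: (@le_trans _ _ (avg P g)); last first.
  rewrite /g !avg_lin avgD (avg_cst P_sum1) (vinv (fun l => z l ^+ 2)) -rateE.
  by rewrite le_eqVlt; apply/orP; left; apply/eqP; ring.
apply: ler_avg => // e Pe; rewrite sum_next_z -/q /g /dissip /incr.
have /andP[w0 w1] := w_bounds Pe; have /andP[v0 vvb] := vP e.2.
have z1 := centered_abs_le zr e.2; rewrite zs mulNr opprK -/S in z1.
have b1 := ler_prod_abs z1 (st e.2).
have b2 := ler_prod_abs (zr e.1 e.2) (st e.2).
have b3 := ler_prod_abs (st e.2) (st e.2).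
move: b1 b2 b3 w0 w1 v0 vvb; rewrite /err.
move: (z e.1) (z e.2) (s e.2) (w e.2 e.1) (v e.2) => zj zi si wij vi.
rewrite [_ * S](_ : _ = 2 * eps * (S / n%:R)); last by ring.
move: (S / n%:R) => m b1 b2 b3 w0 w1 v0 vvb.
pose wv := vi * wij; have wv0 : 0 <= wv by rewrite mulr_ge0// ltW.
have wvb : wv <= vb by rewrite /wv; nra.
have wv2b : wv * wij <= vb by rewrite /wv in wvb *; nra.
have wv20 : 0 <= wv * wij by rewrite mulr_ge0// ltW.
have rt : 0 <= r * t by exact: mulr_ge0.
(* [B1] bounds the error of replacing [z e.2] by its mean, [B2] the cross term of the squared
   increment, [B3] its part of order [eps ^+ 2]. *)
have B1 : wv * ((zi + m) * si) <= vb * (r * t).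
  by apply: (@le_trans _ _ (wv * (r * t))); [rewrite ler_wpM2l|rewrite ler_wpM2r].
have B2 : wv * wij * ((zj - zi) * si) <= vb * (r * t).
  by apply: (@le_trans _ _ (wv * wij * (r * t))); [rewrite ler_wpM2l|rewrite ler_wpM2r].
have B3 : wv * wij * (si * si) <= vb * (t * t).
  by apply: (@le_trans _ _ (wv * wij * (t * t))); [rewrite ler_wpM2l|rewrite ler_wpM2r// mulr_ge0].
rewrite -(ler_pM2l eps0) in B1; rewrite -(ler_pM2l eps0) in B2.
have eps20 : 0 < eps * eps by rewrite mulr_gt0.
rewrite -(ler_pM2l eps20) in B3; rewrite /wv in B1 B2 B3.
by lra.
Qed.

(** The new [s] is the transported one corrected at a single node by [incr], which is at most
    [r + eps * t]; transported entries are at most [2 * t]. *)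
Lemma avg_qform_next_s G : exists2 c, 0 <= c & forall eps z s r t,
  0 < eps -> (forall k l, `|z k - z l| <= r) -> (forall k, `|s k| <= t) ->
  avg P (fun e => qform G (next_s eps e z s)) <=
  qform (transfer P move2 G) s + c * ((r + eps * t) * (2 * t) + (r + eps * t) ^+ 2).
Proof.
have [c c0 cP] := qform_perturb G; exists c => // eps z s r t eps0 zr st.
rewrite -avg_qform_push// -[X in _ <= _ + X](avg_cst P_sum1) -avgD.
apply: ler_avg => // e Pe; have /andP[w0 w1] := w_bounds Pe.
have t0 : 0 <= t by exact: le_trans (st o).
have d_le : `|incr eps e z s| <= r + eps * t.
  apply: (le_trans (ler_normD _ _)); apply: lerD.
    rewrite normrM (gtr0_norm w0) -[leRHS]mul1r ler_pM// ltW//.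
  rewrite !normrM (gtr0_norm w0) (gtr0_norm eps0) -mulrA ler_pM2l//.
  by rewrite -[leRHS]mul1r ler_pM// ltW.
apply: (le_trans (cP _ _ _ _ (push_abs_le e st))); rewrite lerD2l ler_wpM2l//.
apply: lerD; first by rewrite ler_wpM2r// mulr_ge0.
by rewrite -real_normK ?num_real// lerXn2r ?nnegrE// (le_trans (normr_ge0 _) d_le).
Qed.

Lemma rate_gt0 v : (forall i, 0 < v i) -> forall k, 0 < rate v k.
Proof.
move=> v0 k; apply: mulr_gt0 => //.
have term_ge0 j : 0 <= P (j, k) * w k j.
  have := P_ge0 (j, k); rewrite le_eqVlt => /predU1P[<-|Pjk]; first by rewrite mul0r.
  by have /andP[/ltW w0 _] := w_bounds Pjk; rewrite mulr_ge0.
suff [j Pjk] : exists j, 0 < P (j, k).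
  rewrite (bigD1 j)//= ltr_pwDl ?sumr_ge0//.
  by have /andP[w0 _] := w_bounds Pjk; rewrite mulr_gt0.
have [u uk] : exists u, u != k.
  by have [ok|] := eqVneq o k; [exists o'; rewrite -ok eq_sym|exists o].
(* A path from [u != k] to [k] must enter [k]; the invariant along it records that an edge into [k]
   has been found once the path is at [k]. *)
have : k != k \/ exists j, 0 < P (j, k).
  apply: (connect_closed (Q := fun y => y != k \/ _)) (P_connected u k) _; last by left.
  move=> a b Pab _; have [bk|] := eqVneq b k; last by left.
  by right; exists a; rewrite -?bk.
by rewrite eqxx => -[].
Qed.

Lemma lyapunov : exists2 epsb : R, 0 < epsb & forall eps, 0 < eps < epsb ->
  exists V : ('I_n -> R) -> ('I_n -> R) -> R, exists2 c : R, 0 < c &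
  forall z s, \sum_l z l = - \sum_l s l -> 0 <= V z s /\
  avg P (fun e => V (next_z eps e z s) (next_s eps e z s)) <=
    V z s - c * (sqnorm z + sqnorm s).
Proof.
have w_gt0 e : 0 < P e -> 0 < w e.2 e.1 by move=> /w_bounds/andP[].
have [v v0 vinv] := invariant_weights P_ge0 P_connected o w_gt0.
have n0 : 0 < n%:R :> R by rewrite ltr0n (leq_ltn_trans _ (ltn_ord o)).
have n1 : 1 <= n%:R :> R by rewrite ler1n -(ltr0n R).
pose vb := \sum_i v i.
have vbP i : 0 < v i <= vb.
  by rewrite v0 /vb (bigD1 i)//= lerDl sumr_ge0// => j _; exact: ltW.
have vb0 : 0 <= vb by have /andP[/ltW a] := vbP o; exact: le_trans.
have [im vm] := fin_argmin o v.
have [h [alpha alpha0 hP]] := poisson_solution P_ge0 P_sum1 P_connected o (rate_gt0 v0).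
have [U [U1 U2]] := coalescing_form P_ge0 P_sum1 P_loopless P_connected o.
have d_gt0 e : 0 < P e -> 0 < dissip v e.
  by move=> /w_bounds/andP[a b]; rewrite /dissip !mulr_gt0// subr_gt0.
have [c c0 cP] := poincare P_ge0 P_connected d_gt0.
(* With this weight [U] costs [kap * S ^+ 2], half of the gain [2 * alpha / n * S ^+ 2] from the
   Poisson equation. *)
pose kap := alpha / n%:R.
have kap0 : 0 < kap by rewrite divr_gt0.
pose G kl := - (2 / n%:R) * (1 * h kl.2) + kap * U kl.
pose sg (s : 'I_n -> R) := \sum_l s l.
pose hs (s : 'I_n -> R) := \sum_l h l * s l.
have rk g s : qform (fun kl => 1 * g kl.2) s = sg s * \sum_l g l * s l.
  rewrite (qform_rank1 (fun=> 1) g); congr (_ * _).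
  by apply: eq_bigr => l _; rewrite mul1r.
have GE s : qform G s = - (2 / n%:R) * (sg s * hs s) + kap * qform U s.
  by rewrite /G qformD (qformZ (- (2 / n%:R))) (qformZ kap) rk.
have GW s : qform (transfer P move2 G) s <= qform G s
    + 2 / n%:R * sg s * (\sum_k rate v k * s k) - kap * sg s ^+ 2 - kap / 2 * sqnorm s.
  pose G' kl := - (2 / n%:R) * (1 * transfer P move h kl.2) + kap * transfer P move2 U kl.
  rewrite (eq_qform (K' := G')); last first.
    move=> kl; rewrite /G /G' transfer_lin; congr (_ * _ + _); last exact: avgZ.
    by rewrite mul1r; apply: eq_avg => e; rewrite mul1r.
  rewrite GE /G' qformD (qformZ (- (2 / n%:R))) (qformZ kap) rk.
  have -> : \sum_l transfer P move h l * s l =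
      hs s - \sum_k rate v k * s k + alpha * sg s.
    rewrite /hs /sg mulr_sumr -sumrB -big_split; apply: eq_bigr => k _ /=.
    by rewrite hP; ring.
  have := U2 s; rewrite -/(sg s) -(ler_pM2l kap0).
  rewrite /kap; move: (n%:R^-1) => m; lra.
pose H := \sum_l `|h l|.
have H0 : 0 <= H by exact: sumr_ge0.
(* Lower bound for [G]: complete the square in the norm of [s], leaving only a multiple of [S ^+ 2],
   which the [z] part of [V] will pay because [S] is minus the sum of [z]. *)
have GL s : - (H ^+ 2 / kap) * sg s ^+ 2 <= qform G s.
  rewrite GE; set t := Num.sqrt (sqnorm s).
  have t2 : t ^+ 2 = sqnorm s by rewrite sqr_sqrtr// sqnorm_ge0.
  have hst : `|hs s| <= H * t.
    apply: (le_trans (ler_norm_sum _ _ _)); rewrite mulr_suml; apply: ler_sum => l _.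
    by rewrite normrM ler_wpM2l// ler_abs_sqnorm.
  have B1 := ler_prod_abs (lexx `|sg s|) hst.
  have X0 : 0 <= `|sg s| * (H * t) by rewrite !mulr_ge0// sqrtr_ge0.
  have B2 : 2 / n%:R * (sg s * hs s) <= 2 * (`|sg s| * (H * t)).
    apply: (@le_trans _ _ (2 / n%:R * (`|sg s| * (H * t)))).
      by rewrite ler_wpM2l// divr_ge0// ltW.
    by rewrite ler_wpM2r// ler_pdivrMr//; lra.
  have B3 := U1 s; rewrite -(ler_pM2l kap0) -t2 in B3.
  have B4 : 0 <= kap * (t - H * `|sg s| / kap) ^+ 2 by rewrite mulr_ge0 ?sqr_ge0// ltW.
  have B5 : kap * (t - H * `|sg s| / kap) ^+ 2 =
      kap * t ^+ 2 - 2 * (`|sg s| * (H * t)) + H ^+ 2 / kap * `|sg s| ^+ 2.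
    by field; rewrite gt_eqF.
  rewrite B5 real_normK ?num_real// in B4; lra.
have [C C0 CP] := avg_qform_next_s G.
pose K := 4 * vb + 4 * C.
have K0 : 0 <= K by rewrite /K; lra.
(* [e1] and [e2] supply the smallness conditions of [error_absorbed], [e3] the nonnegativity of
   [V]. *)
pose e1 := c / (4 * (K + 1)).
pose e2 := kap / (4 * (K ^+ 2 / c + K + 1)).
pose e3 := v im * kap / (n%:R ^+ 2 * H ^+ 2 + 1).
exists (Num.min (Num.min 1 e1) (Num.min e2 e3)) => [|eps].
  have k2 : 0 <= K ^+ 2 / c by rewrite divr_ge0 ?sqr_ge0// ltW.
  have nH : 0 <= n%:R ^+ 2 * H ^+ 2 by rewrite mulr_ge0// sqr_ge0.
  rewrite !lt_min ltr01 /=; apply/and3P; split; apply: divr_gt0 => //.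
  - by rewrite mulr_gt0//; lra.
  - by rewrite mulr_gt0//; lra.
  - exact: mulr_gt0.
  - by lra.
rewrite !lt_min => /andP[eps0 /andP[/andP[eps1 eps_e1] /andP[eps_e2 eps_e3]]].
have cond1 : K * eps <= c / 4.
  by move: eps_e1; rewrite ltr_pdivlMr; lra.
have cond2 : (K ^+ 2 / c + K) * eps <= kap / 4.
  have k2 : 0 <= K ^+ 2 / c by rewrite divr_ge0 ?sqr_ge0// ltW.
  move: eps_e2; rewrite ltr_pdivlMr; last by lra.
  by move: (K ^+ 2 / c) k2 => k2; lra.
have cond3 : eps * (n%:R ^+ 2 * H ^+ 2) <= v im * kap.
  have nH : 0 <= n%:R ^+ 2 * H ^+ 2 by rewrite mulr_ge0// sqr_ge0.
  by move: eps_e3; rewrite ltr_pdivlMr; lra.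
pose V z s := \sum_l v l * z l ^+ 2 + eps * qform G s.
(* Fits what is left after absorbing errors: [c / 2 * r ^+ 2], [eps * kap * S ^+ 2] and
   [eps * kap / 4 * sqnorm s]. *)
pose cc := Num.min (c / (4 * n%:R)) (eps * kap / (4 * n%:R)).
have n4 : 0 < 4 * n%:R :> R by rewrite mulr_gt0.
have cc0 : 0 < cc.
  by rewrite lt_min; apply/andP; split; apply: divr_gt0 => //; exact: mulr_gt0.
exists V, cc => // z s zs; split.
  have q_ge : v im * sqnorm z <= \sum_l v l * z l ^+ 2.
    by rewrite mulr_sumr; apply: ler_sum => l _; rewrite ler_wpM2r// sqr_ge0.
  have S2 : sg s ^+ 2 <= n%:R ^+ 2 * sqnorm z.
    by rewrite -[sg s]opprK -zs sqrrN sqr_sum_le.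
  have Hk : 0 <= eps * (H ^+ 2 / kap) by rewrite mulr_ge0 ?divr_ge0 ?sqr_ge0// ltW.
  have := GL s; rewrite -(ler_pM2l eps0) => GLs.
  have {}S2 := ler_wpM2l Hk S2.
  have : eps * (H ^+ 2 / kap) * (n%:R ^+ 2 * sqnorm z) <= v im * sqnorm z.
    rewrite mulrA ler_wpM2r ?sqnorm_ge0//.
    rewrite (_ : _ * _ = eps * (n%:R ^+ 2 * H ^+ 2) / kap); last by ring.
    by rewrite ler_pdivrMr.
  rewrite /V; lra.
set D := avg P (fun e => dissip v e * (z e.1 - z e.2) ^+ 2).
have D0 : 0 <= D.
  by apply: avg_ge0 => // e /d_gt0 d0; rewrite mulr_ge0 ?sqr_ge0// ltW.
pose r := Num.sqrt (D / c); pose t := Num.sqrt (sqnorm s).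
have zr k l : `|z k - z l| <= r.
  by rewrite -sqrtr_sqr ler_wsqrtr// ler_pdivlMr// mulrC.
have st k : `|s k| <= t by exact: ler_abs_sqnorm.
have r2 : c * r ^+ 2 = D.
  by rewrite /r sqr_sqrtr ?divr_ge0 ?(ltW c0)// mulrC divfK// gt_eqF.
have t2 : t ^+ 2 = sqnorm s by rewrite sqr_sqrtr// sqnorm_ge0.
have r0 : 0 <= r by exact: sqrtr_ge0.
have t0 : 0 <= t by exact: sqrtr_ge0.
have Q1 := avg_sum_next_z vbP vinv eps0 zs zr st.
have Q2 := CP eps z s r t eps0 zr st.
have Q3 := GW s.
have eps01 : 0 < eps <= 1 by rewrite eps0 ltW.
have Q4 := error_absorbed c0 vb0 C0 eps01 r0 t0 cond1 cond2.
(* [z] is recovered from its differences, bounded by [r], and its mean, bounded by [S] in absolute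
   value. *)
have zn : sqnorm z <= n%:R * (2 * r ^+ 2 + 2 * sg s ^+ 2).
  have -> : n%:R * (2 * r ^+ 2 + 2 * sg s ^+ 2) =
      \sum_(k < n) (2 * r ^+ 2 + 2 * sg s ^+ 2).
    by rewrite sumr_const card_ord mulr_natl.
  apply: ler_sum => k _; have := centered_abs_le zr k; rewrite zs.
  set m := _ / _ => zm.
  have m2 : m ^+ 2 <= sg s ^+ 2.
    rewrite /m expr_div_n sqrrN -/(sg s) ler_pdivrMr ?exprn_gt0//.
    by rewrite ler_peMr ?sqr_ge0// exprn_ege1.
  have zm2 : (z k - m) ^+ 2 <= r ^+ 2.
    by rewrite -real_normK ?num_real// lerXn2r ?nnegrE.
  have := sqr_ge0 (z k - 2 * m); lra.
have S0 := sqr_ge0 (sg s); have r20 := sqr_ge0 r; have sq0 := sqnorm_ge0 s.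
have [cc1 cc2] : cc * n%:R <= c / 4 /\ cc * n%:R <= eps * kap / 4.
  have nn : n%:R != 0 :> R by rewrite gt_eqF.
  have -> : c / 4 = c / (4 * n%:R) * n%:R by field.
  have -> : eps * kap / 4 = eps * kap / (4 * n%:R) * n%:R by field.
  by rewrite !ler_pM2r// !ge_min !lexx orbT.
have cc3 : cc <= eps * kap / 4 by apply: le_trans cc2; rewrite ler_peMr// ltW.
have W1 : cc * sqnorm z <= cc * (n%:R * (2 * r ^+ 2 + 2 * sg s ^+ 2)).
  by rewrite ler_wpM2l// ltW.
have W2 : cc * n%:R * r ^+ 2 <= c / 4 * r ^+ 2 by rewrite ler_wpM2r.
have W3 : cc * n%:R * sg s ^+ 2 <= eps * kap / 4 * sg s ^+ 2 by rewrite ler_wpM2r.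
have W4 : cc * sqnorm s <= eps * kap / 4 * sqnorm s by rewrite ler_wpM2r.
have W5 := mulr_ge0 (mulr_ge0 (ltW eps0) (ltW kap0)) S0.
rewrite -/(sg s) -/D in Q1; rewrite -(ler_pM2l eps0) in Q2; rewrite -(ler_pM2l eps0) in Q3.
rewrite t2 in Q4; rewrite t2 in Q1.
rewrite /V avgD avgZ.
move: Q1 Q2 Q3 Q4 W1 W2 W3 W4 W5; rewrite -r2.
move: (n%:R^-1) => m; lra.
Qed.
End Lyapunov.

(** * Expectations as iterates of a one-step operator *)

Lemma sum_tuple_cons (R : realType) (T : finType) k (F : seq T -> R) :
  \sum_(t : k.+1.-tuple T) F t = \sum_e \sum_(t : k.-tuple T) F (e :: t).
Proof.
rewrite pair_bigA (reindex (fun q : T * k.-tuple T => cons_tuple q.1 q.2)) //=.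
exists (fun t : k.+1.-tuple T => (thead t, behead_tuple t)) => [[e t] _|t _] /=.
  by congr (_, _); apply: val_inj.
by apply: val_inj; case/tupleP: t.
Qed.

Section Expectation.
Context {R : realType} {n : nat}.
Variables (E : rel 'I_n) (p w : 'I_n -> 'I_n -> R) (eps : R).
Local Notation P := (edge_prob E p).
Implicit Types (f g : state R n -> R) (st : state R n).

Definition forward f st : R := avg P (fun e => f (gossip_step w eps e st)).

(** Condition on the first edge: the product weight of a sequence factors. *)
Lemma gossip_expect_iter x0 k f :
  gossip_expect E p w eps x0 k f = iter k forward f (x0, fun=> 0).
Proof.
rewrite /gossip_expect; move: (x0, fun=> 0) => st.
elim: k st => [|k IHk] st.
  rewrite (big_pred1 [tuple]) ?big_nil ?mul1r// => t.
  by apply/esym/eqP; exact: tuple0.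
rewrite (sum_tuple_cons k
  (fun t => (\prod_(e <- t) P e) * f (gossip_run w eps t st))).
rewrite iterS /forward /avg; apply: eq_bigr => e _; rewrite -IHk mulr_sumr.
by apply: eq_bigr => t _; rewrite big_cons -mulrA.
Qed.

Lemma iter_forward_lin k c f g st :
  iter k forward (fun st => c * f st + g st) st =
  c * iter k forward f st + iter k forward g st.
Proof.
elim: k st => [//|k IHk] st; rewrite !iterS /forward -avg_lin.
by apply: eq_avg => e; exact: IHk.
Qed.

Hypothesis P_ge0 : forall e, 0 <= P e.
Variable Inv : state R n -> Prop.
Hypothesis Inv_step : forall e st, 0 < P e -> Inv st -> Inv (gossip_step w eps e st).

(** Comparison on an invariant set suffices, as the Lyapunov bounds hold only where the sums of [z]
    and [s] cancel. *)
Lemma ler_iter_forward f g k st : (forall st, Inv st -> f st <= g st) -> Inv st ->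
  iter k forward f st <= iter k forward g st.
Proof.
move=> fg; elim: k st => [|k IHk] st Ist; first exact: fg.
by rewrite !iterS; apply: ler_avg => // e Pe; apply/IHk/Inv_step.
Qed.

Hypothesis P_sum1 : \sum_e P e = 1.

Lemma iter_forward_cst k c st : iter k forward (fun=> c) st = c.
Proof.
elim: k st => [//|k IHk] st; rewrite iterS /forward.
by rewrite (eq_avg _ (g := fun=> c)) ?avg_cst.
Qed.

(** The decrease of [V] telescopes, so [c] times the sum of the means of [N] stays below [V st]; a
    convergent series has terms tending to 0. *)
Lemma lyapunov_cvg0 (V N : state R n -> R) (c : R) st :
  0 < c -> Inv st -> (forall st, Inv st -> 0 <= V st) ->
  (forall st, 0 <= N st) ->
  (forall st, Inv st -> forward V st <= V st - c * N st) ->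
  ((fun k => iter k forward N st) @ \oo --> (0 : R))%classic.
Proof.
move=> c0 Ist V0 N0 VN; set u := fun k => _.
have u0 k : 0 <= u k.
  by rewrite -[leLHS](iter_forward_cst k 0 st); exact: ler_iter_forward.
have sumu k : c * \sum_(i < k) u i <= V st - iter k forward V st.
  elim: k => [|k IHk]; first by rewrite big_ord0 mulr0 subrr.
  have : iter k.+1 forward V st <= - c * u k + iter k forward V st.
    rewrite iterSr -iter_forward_lin; apply: ler_iter_forward => // st' Ist'.
    by apply: (le_trans (VN _ Ist')); lra.
  by rewrite big_ord_recr mulrDr /=; lra.
apply: cvg_series_cvg_0; apply: nondecreasing_is_cvgn.
  by apply: nondecreasing_series => k _ _; exact: u0.
exists (V st / c) => _ [k _ <-]; rewrite /series /= big_mkord ler_pdivlMr// mulrC.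
apply: (le_trans (sumu k)); rewrite gerBl.
by rewrite -[leLHS](iter_forward_cst k 0 st); exact: ler_iter_forward.
Qed.

End Expectation.

(** * The two implications *)

Section ConsensusCriterion.
Context {R : realType} {n : nat}.
Variables (E : rel 'I_n) (p w : 'I_n -> 'I_n -> R).
Hypothesis n_gt1 : (1 < n)%N.
Hypothesis E_loopless : forall i : 'I_n, ~~ E i i.
Hypothesis p_bounds : forall i j : 'I_n, E j i -> 0 < p i j < 1.
Hypothesis p_sum1 : \sum_(e : 'I_n * 'I_n | E e.1 e.2) p e.2 e.1 = 1.
Hypothesis w_bounds : forall i j : 'I_n, E j i -> 0 < w i j < 1.
Local Notation P := (edge_prob E p).

Lemma edge_prob_gt0 e : (0 < P e) = E e.1 e.2.
Proof.
by rewrite /edge_prob; case: ifP => [/p_bounds/andP[->]|]//; rewrite ltxx.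
Qed.

Lemma edge_prob_ge0 e : 0 <= P e.
Proof. by rewrite /edge_prob; case: ifP => // /p_bounds/andP[/ltW]. Qed.

Lemma edge_prob_sum1 : \sum_e P e = 1.
Proof. by rewrite -p_sum1 [RHS]big_mkcond. Qed.

Lemma strongly_connected_consensus : strongly_connected E ->
  exists epsb : R, 0 < epsb /\
    forall eps : R, 0 < eps < epsb -> ms_average_consensus E p w eps.
Proof.
move=> sconn.
have loopless e : 0 < P e -> e.1 != e.2.
  by rewrite edge_prob_gt0; apply: contraTneq => ->.
have Pconn u v : connect (fun j i => 0 < P (j, i)) u v.
  by rewrite (eq_connect (e' := E)) ?sconn// => j i; rewrite edge_prob_gt0.
have wP e : 0 < P e -> 0 < w e.2 e.1 < 1 by rewrite edge_prob_gt0; exact: w_bounds.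
pose o := Ordinal (ltnW n_gt1); pose o' := Ordinal n_gt1.
have [epsb epsb0 lyap] := lyapunov edge_prob_ge0 edge_prob_sum1 loopless Pconn wP
  (isT : o != o').
exists epsb; split=> // eps /lyap[V [c c0 VP]] x0.
set a := xavg x0; pose dev (st : state R n) l := st.1 l - a.
have step1 e st : e.1 != e.2 ->
    dev (gossip_step w eps e st) = next_z w eps e (dev st) st.2.
  move=> ne; apply/funext => l; rewrite /dev /next_z /incr /=.
  by case: eqP => [->|_] /=; ring.
have step2 e st : e.1 != e.2 ->
    (gossip_step w eps e st).2 = next_s w eps e (dev st) st.2.
  move=> ne; apply/funext => l; rewrite /dev /next_s /push /incr /=.
  by case: eqP => _ /=; ring.
(* Conservation law: what [x] gains at a node is subtracted from [s], and transport preserves the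
   sum of [s]. *)
pose Inv st := \sum_l dev st l = - \sum_l st.2 l.
have Inv0 : Inv (x0, fun=> 0).
  rewrite /Inv /dev /= sumrB sumr_const card_ord [X in _ = - X]big1// oppr0 /a /xavg.
  by rewrite -[_ *+ n]mulr_natr divfK ?subrr// pnatr_eq0 -lt0n ltnW.
have sum_at i (d : R) : \sum_l d * (l == i :> 'I_n)%:R = d.
  by rewrite (bigD1 i)//= eqxx mulr1 big1 ?addr0// => l /negbTE ->; rewrite mulr0.
have InvS e st : 0 < P e -> Inv st -> Inv (gossip_step w eps e st).
  move=> /loopless ne Ist; rewrite /Inv step1// step2// /next_z /next_s.
  rewrite big_split /= Ist sumrB !sum_at.
  have := sum_push (fun=> 1) st.2 ne.
  by under eq_bigr do rewrite mul1r; under [RHS]eq_bigr do rewrite mul1r; lra.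
pose N st := sqnorm (dev st) + sqnorm st.2.
have cvgN : ((fun k => iter k (forward E p w eps) N (x0, fun=> 0)) @ \oo --> (0 : R))%classic.
  apply: (@lyapunov_cvg0 _ _ _ _ _ _ edge_prob_ge0 Inv InvS edge_prob_sum1
    (fun st => V (dev st) st.2) N c) => // [st Ist|st|st Ist].
  - by have [] := VP _ _ Ist.
  - by rewrite addr_ge0// sqnorm_ge0.
  - have [_] := VP _ _ Ist; apply: le_trans.
    rewrite /forward; apply: (ler_avg edge_prob_ge0) => e Pe.
    by rewrite step1 ?step2 ?loopless.
have main f : (forall st, 0 <= f st <= N st) ->
    ((fun k => gossip_expect E p w eps x0 k f) @ \oo --> (0 : R))%classic.
  move=> fN; apply: (squeeze_cvgr _ (cvg_cst 0) cvgN).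
  apply: nearW => k; rewrite gossip_expect_iter.
  rewrite -[X in X <= _](@iter_forward_cst _ _ E p w eps edge_prob_sum1 k 0 (x0, fun=> 0)).
  by rewrite !(ler_iter_forward edge_prob_ge0 (Inv := fun=> True))// => st _;
    have /andP[] := fN st.
split; apply: main => st; rewrite /N !sqnorm_ge0 /=.
  by rewrite lerDl sqnorm_ge0.
by rewrite lerDr sqnorm_ge0.
Qed.

Lemma consensus_strongly_connected eps :
  ms_average_consensus E p w eps -> strongly_connected E.
Proof.
move=> cons u v; apply: contraT => uv.
pose x0 l : R := (connect E u l)%:R.
have [+ _] := cons x0; set a := xavg x0 => cvg0.
pose Inv (st : state R n) :=
  forall l, ~~ connect E u l -> st.1 l = 0 /\ st.2 l = 0.
have Inv0 : Inv (x0, fun=> 0) by move=> l /negbTE ul; rewrite /= /x0 ul.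
have InvS e st : 0 < P e -> Inv st -> Inv (gossip_step w eps e st).
  rewrite edge_prob_gt0 => Ee Ist l ul; rewrite /=; case: eqP => [le|_].
    have [xl sl] := Ist l ul; rewrite -le xl sl.
    (* An edge into an unreachable node starts at an unreachable node, so only zeros arrive. *)
    have [|-> ->] := Ist e.1; last by split; ring.
    apply: contra ul => ue; rewrite le.
    exact: connect_trans ue (connect1 Ee).
  by have [-> ->] := Ist l ul; split=> //; case: ifP.
have n0 : 0 < n%:R :> R by rewrite ltr0n ltnW.
have a0 : 0 < a.
  rewrite divr_gt0// (bigD1 u)//= /x0 connect0 ltr_pwDl// sumr_ge0//.
(* Node [v] keeps the value 0, hence deviation [- a], so the expected error never drops below
   [a ^+ 2], yet tends to 0. *)
have : a ^+ 2 <= 0.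
  apply: (cvgr_to_ge cvg0); apply: nearW => k; rewrite gossip_expect_iter.
  rewrite -[leLHS](@iter_forward_cst _ _ E p w eps edge_prob_sum1 k _ (x0, fun=> 0)).
  apply: (ler_iter_forward edge_prob_ge0 InvS) => // st Ist.
  rewrite /sqnorm (bigD1 v)//=; have [-> _] := Ist v uv.
  by rewrite sub0r sqrrN lerDl sumr_ge0// => l _; exact: sqr_ge0.
by rewrite leNgt exprn_gt0.
Qed.

End ConsensusCriterion.

Theorem theorem2 (R : realType) (n : nat) (E : rel 'I_n)
    (p w : 'I_n -> 'I_n -> R) :
  (1 < n)%N ->
  (forall i : 'I_n, ~~ E i i) ->
  (forall i j : 'I_n, E j i -> 0 < p i j < 1) ->
  (\sum_(e : 'I_n * 'I_n | E e.1 e.2) p e.2 e.1 = 1) ->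
  (forall i j : 'I_n, E j i -> 0 < w i j < 1) ->
  (strongly_connected E <->
   exists epsb : R, 0 < epsb /\
     forall eps : R, 0 < eps < epsb -> ms_average_consensus E p w eps).
Proof.
move=> n_gt1 loopless pP psum wP; split.
  exact: strongly_connected_consensus.
move=> [epsb [epsb0 cons]]; apply: (consensus_strongly_connected n_gt1 pP psum).
by apply: (cons (epsb / 2)); lra.
Qed.
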